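(* Let $\Lambda$ be a numerical semigroup and let $p$ be an admissible premonic pattern. Then there exists a unique closure of $\Lambda$ with respect to $p$, and it is exactly $p^k(\Lambda)$, where $k$ is the minimal nonnegative integer such that $p^k(\Lambda)=p^{k+1}(\Lambda)$.
   Context: $\mathbb{N}$ denotes the set of nonnegative integers. A numerical semigroup is a subset of $\mathbb{N}$ that contains $0$, is closed under addition and has finite complement in $\mathbb{N}$. A pattern of length $n$ is a linear homogeneous polynomial $p=\sum_{i=1}^n a_ix_i$ with all $a_i$ non-zero integers (for $n=0$ the unique pattern is $p=0$). A numerical semigroup $\Lambda$ admits $p$ if $p(s_1,\dots,s_n)\in\Lambda$ for all $s_1\geq s_2\geq\dots\geq s_n$ in $\Lambda$. The pattern $p$ is admissible if some numerical semigroup admits it, equivalently if $\sum_{i=1}^{n'}a_i\ge 0$ for all $1\le n'\le n$. The pattern $p$ is premonic if $\sum_{i=1}^{n'}a_i=1$ for some $1\le n'\leq n$. A covering of a numerical semigroup $\Lambda$ with respect to an admissible pattern $p$ is a numerical semigroup containing $\Lambda$ and admitting $p$. A closure of $\Lambda$ with respect to $p$ is a covering of $\Lambda$ with respect to $p$ that does not properly contain any other covering of $\Lambda$ with respect to $p$. For $A\subseteq\mathbb{N}$ and an admissible pattern $p$ of length $n$, $p(A)=\{p(s_1,\dots,s_n)\mid s_1\geq s_2\geq\dots\geq s_n,\ s_1,\dots,s_n\in A\}$, and $p^k(A)$ is the result of applying $A\mapsto p(A)$ $k$ times, with $p^0(A)=A$. *)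

(* Defs.v *)
From mathcomp Require Import all_boot all_order all_algebra.
From mathcomp Require Import mathcomp_extra boolp classical_sets functions.
From mathcomp Require Import cardinality.

Set Implicit Arguments.
Unset Strict Implicit.
Unset Printing Implicit Defensive.

Import Order.TTheory GRing.Theory Num.Theory.

Local Open Scope classical_set_scope.
Local Open Scope ring_scope.

Definition numerical_semigroup (L : set nat) : Prop :=
  [/\ L 0%N,
      forall x y : nat, L x -> L y -> L (x + y)%N
    & finite_set (~` L)].

(* The polynomial a_1 x_1 + ... + a_n x_n, given by its coefficients; the
   coefficient a_i is [coef p] at the ordinal of value i - 1. *)
Record pattern (n : nat) := Pattern {
  coef : 'I_n -> int;
  coef_neq0 : forall i : 'I_n, coef i != 0
}.

Definition peval n (p : pattern n) (s : 'I_n -> nat) : int :=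
  \sum_(i < n) coef p i * (s i)%:Z.

Definition nonincreasing_in n (A : set nat) (s : 'I_n -> nat) : Prop :=
  (forall i : 'I_n, A (s i)) /\
  (forall i j : 'I_n, (i <= j)%N -> (s j <= s i)%N).

(* [Posz @` L] is [L] seen inside the integers, where [p] takes its values. *)
Definition admits n (L : set nat) (p : pattern n) : Prop :=
  forall s : 'I_n -> nat, nonincreasing_in L s -> (Posz @` L) (peval p s).

Definition admissible n (p : pattern n) : Prop :=
  exists L : set nat, numerical_semigroup L /\ admits L p.

Definition premonic n (p : pattern n) : Prop :=
  exists m : nat, (1 <= m <= n)%N /\ \sum_(i < n | (i < m)%N) coef p i = 1.

Definition covering n (p : pattern n) (L C : set nat) : Prop :=
  [/\ numerical_semigroup C, L `<=` C & admits C p].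

Definition closure_wrt n (p : pattern n) (L C : set nat) : Prop :=
  covering p L C /\ (forall D : set nat, covering p L D -> ~ (D `<` C)).

(* p(A), as a set of natural numbers: no value is lost when [p] is admissible,
   since [p] is then nonnegative on nonincreasing sequences of naturals. *)
Definition pimage n (p : pattern n) (A : set nat) : set nat :=
  [set m : nat | exists2 s : 'I_n -> nat,
                   nonincreasing_in A s & peval p s = m%:Z].

Definition piter n (p : pattern n) (k : nat) (A : set nat) : set nat :=
  iter k (pimage p) A.

(* Main.v *)
Require Import Defs.
From mathcomp Require Import all_boot all_order all_algebra.
From mathcomp Require Import boolp classical_sets.
From mathcomp Require Import cardinality.

(** If [p] has a partial coefficient sum equal to 1, then evaluating [p] at
    [(x, .., x, 0, .., 0)] gives [x], so [A] is contained in [p(A)] as soon as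
    [A] contains 0.  The sets [p^j(L)] are thus an increasing chain of numerical
    semigroups, which stabilizes because [L] has finite complement.  A
    stationary value admits [p], and it is contained in every covering of [L]
    because coverings are stable under [A |-> p(A)]: it is the least covering. *)

Set Implicit Arguments.
Unset Strict Implicit.
Unset Printing Implicit Defensive.

Import Order.TTheory GRing.Theory Num.Theory.

Local Open Scope classical_set_scope.
Local Open Scope ring_scope.

Lemma cofinite_natP (A : set nat) :
  finite_set (~` A) -> exists N : nat, forall x, (N <= x)%N -> A x.
Proof.
(* The bound is one more than the largest gap listed in [s]. *)
case/finite_seqP => s sE; exists (\max_(y <- s) y).+1 => x ltx.
apply: contrapT => nAx; have : (~` A) x by [].
by rewrite sE /= => xs; move: ltx; rewrite ltnNge leq_bigmax_seq.
Qed.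

(** Only the finitely many [x] below some [N] can be missing from [u 0]. Each of them that ever
    enters the chain does so by some stage, and the largest of these stages works. *)
Lemma nondecreasing_cofinite_stationary (u : nat -> set nat) :
  (forall i j, (i <= j)%N -> u i `<=` u j) -> finite_set (~` u 0%N) ->
  exists k, u k = u k.+1.
Proof.
move=> u_mono /cofinite_natP[N u0N].
(* [f x] is a stage containing [x], with default value 0 if [x] never appears. *)
have /choice[f fP] : forall x, exists j, forall i, u i x -> u j x.
  move=> x; have [[j ujx]|nu] := pselect (exists j, u j x); first by exists j.
  by exists 0%N => i uix; case: nu; exists i.
exists (\max_(x < N) f x)%N; apply/seteqP; split; first exact: u_mono.
move=> x /fP ufx; have [leNx|ltxN] := leqP N x.
  by apply: (u_mono 0%N) => //; exact: u0N.
exact: u_mono (leq_bigmax (Ordinal ltxN)) _ ufx.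
Qed.

Section Patterns.
Variables (n : nat) (p : pattern n).
Implicit Types A C D L : set nat.

Lemma pevalD (s t : 'I_n -> nat) :
  peval p (fun i => (s i + t i)%N) = peval p s + peval p t.
Proof.
by rewrite /peval -big_split; apply: eq_bigr => i _; rewrite PoszD mulrDr.
Qed.

Lemma pevalM (N : nat) (s : 'I_n -> nat) :
  peval p (fun i => (N * s i)%N) = N%:Z * peval p s.
Proof.
by rewrite /peval mulr_sumr; apply: eq_bigr => i _; rewrite PoszM mulrCA.
Qed.

(* Scaling [s] by a large [N] moves all its nonzero entries beyond the
   conductor of a semigroup that admits [p]. *)
Lemma admissible_peval_ge0 (s : 'I_n -> nat) :
  admissible p -> nonincreasing_in setT s -> 0 <= peval p s.
Proof.
move=> [L [[L0 _ /cofinite_natP[N LN]] Lp]] [_ s_mono].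
(* The factor is [N.+1] rather than [N] so that it is positive and does not affect the sign. *)
have [|m _ mE] := Lp (fun i => (N.+1 * s i)%N).
  split=> [i|i j le_ij]; last by rewrite leq_mul2l s_mono.
  have [->|s_gt0] := posnP (s i); first by rewrite muln0.
  by apply: LN; apply: (leq_trans (leqnSn N)); rewrite leq_pmulr.
by rewrite -(@pmulr_rge0 _ N.+1%:Z) // -pevalM -mE.
Qed.

Lemma nonincreasing_inW A D (s : 'I_n -> nat) :
  A `<=` D -> nonincreasing_in A s -> nonincreasing_in D s.
Proof. by move=> AD [As s_mono]; split=> // i; apply: AD. Qed.

Lemma pimageS A D : A `<=` D -> pimage p A `<=` pimage p D.
Proof. by move=> AD m [s /(nonincreasing_inW AD) Ds sE]; exists s. Qed.

Lemma admits_pimage A : admits A p -> pimage p A `<=` A.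
Proof. by move=> Ap m [s /Ap[m' Am' <-] [<-]]. Qed.

(** [pimage] only records natural values, so a negative value of [p] would go unnoticed;
    admissibility rules it out. *)
Lemma pimage_admits A : admissible p -> pimage p A `<=` A -> admits A p.
Proof.
move=> p_adm pA s As.
have := admissible_peval_ge0 p_adm (nonincreasing_inW (@subsetT _ A) As).
by case E: (peval p s) => [m|//] _; exists m => //; apply: pA; exists s.
Qed.

Lemma premonic_sub_pimage A : premonic p -> A 0%N -> A `<=` pimage p A.
Proof.
move=> [m [_ sum1]] A0 x Ax; exists (fun i => if (i < m)%N then x else 0%N).
  split=> [i|i j le_ij]; first by case: ifP.
  by case: (ltnP j m) => // /(leq_ltn_trans le_ij) ->.
rewrite -[RHS]mul1r -sum1 mulr_suml [RHS]big_mkcond.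
by apply: eq_bigr => i _; case: ifP => //; rewrite mulr0.
Qed.

(** Nonincreasing sequences add up entrywise and [p] is additive, whence closure under sums; the
    complement can only shrink because [A] is contained in its image. *)
Lemma numerical_semigroup_pimage A :
  premonic p -> numerical_semigroup A -> numerical_semigroup (pimage p A).
Proof.
move=> p_pre [A0 AD Afin]; have ApA := premonic_sub_pimage p_pre A0.
split; first exact: ApA.
  move=> x y [s [As s_mono] sE] [t [At t_mono] tE].
  exists (fun i => (s i + t i)%N); last by rewrite pevalD sE tE PoszD.
  by split=> [i|i j le_ij]; [apply: AD | rewrite leq_add ?s_mono ?t_mono].
by apply: sub_finite_set Afin; apply: subsetC.
Qed.

Lemma numerical_semigroup_piter L k :
  premonic p -> numerical_semigroup L -> numerical_semigroup (piter p k L).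
Proof.
by move=> p_pre L_sg; elim: k => //= k; exact: numerical_semigroup_pimage.
Qed.

Lemma piter_nondecreasing L i j :
  premonic p -> numerical_semigroup L -> (i <= j)%N ->
  piter p i L `<=` piter p j L.
Proof.
move=> p_pre L_sg /subnK <-; elim: (j - i)%N => //= d /subset_trans; apply.
by have [A0 _ _] := numerical_semigroup_piter (d + i) p_pre L_sg;
  apply: premonic_sub_pimage.
Qed.

Lemma piter_sub_covering L D k : covering p L D -> piter p k L `<=` D.
Proof.
move=> [_ LD Dp]; elim: k => //= k IHk.
exact: subset_trans (pimageS IHk) (admits_pimage Dp).
Qed.

Lemma stationary_covering L k :
  numerical_semigroup L -> admissible p -> premonic p ->
  piter p k L = piter p k.+1 L -> covering p L (piter p k L).
Proof.
move=> L_sg p_adm p_pre kE; split; first exact: numerical_semigroup_piter.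
  exact: (@piter_nondecreasing L 0).
(* Rewriting only the right-hand side turns the inclusion into reflexivity, since [piter p k.+1 L]
   unfolds to the image of [piter p k L]. *)
by apply: pimage_admits => //; rewrite [X in _ `<=` X]kE.
Qed.

(** In an ordered set with a least element, that element is the only minimal one. *)
Lemma least_covering_closure L C :
  covering p L C -> (forall D, covering p L D -> C `<=` D) ->
  forall D, closure_wrt p L D <-> D = C.
Proof.
move=> C_cov C_min D; split=> [[D_cov D_min]|->].
  have CD := C_min D D_cov; apply/seteqP; split=> //.
  by apply: contrapT => nDC; apply: (D_min C C_cov); split.
by split=> // E /C_min CE [_]; apply.
Qed.

End Patterns.

Theorem theorem25 (L : set nat) (n : nat) (p : pattern n) :
  numerical_semigroup L -> admissible p -> premonic p ->
  (exists! C : set nat, closure_wrt p L C) /\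
  (exists k : nat,
    [/\ piter p k L = piter p k.+1 L,
        forall j : nat, piter p j L = piter p j.+1 L -> (k <= j)%N
      & closure_wrt p L (piter p k L)]).
Proof.
move=> L_sg p_adm p_pre; have [_ _ L_fin] := L_sg.
have [k0 k0E] : exists k, piter p k L = piter p k.+1 L.
  apply: (@nondecreasing_cofinite_stationary (piter p ^~ L)) => // i j.
  exact: piter_nondecreasing.
have ex_k : exists k, `[< piter p k L = piter p k.+1 L >].
  by exists k0; apply/asboolP.
have [k /asboolP kE k_min] := ex_minnP ex_k.
(* This equivalence yields existence, uniqueness and the explicit form of the closure at once. *)
have closureE := least_covering_closure
  (stationary_covering L_sg p_adm p_pre kE) (@piter_sub_covering _ p L ^~ k).
split; first by exists (piter p k L); split=> [|D /closureE->//]; apply/closureE.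
by exists k; split=> // [j /asboolP/k_min//|]; apply/closureE.
Qed.
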